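(* Let $A>1$, $\omega(x)=(\log x)^A$, let $r\ge1$ and $h$ be integers and let $s\in[0,1]$ be such that $h-s>(A-1)^A$. Let $\mu=\mu_{h,r,s}$ be the unique stationary point of $k\mapsto\phi(k,r)-(h-s)k$, i.e. the unique solution of $(\partial_\mu\phi)(\mu,r)=h-s$, and let $\Phi(h,r,s):=\phi(\mu,r)-(h-s)\mu$. Then $$\mu_{h,r,s}=\frac{r}{\omega'(\omega^{-1}(h-s))},\qquad \Phi(h,r,s)=-r\,\omega^{-1}(h-s),$$ and moreover $$\mu\,\omega''(x_{\mu,r})\cdot(\partial_{\mu\mu}\phi)(\mu,r)=-\frac{r^2}{\mu^2}.$$
   Context: $\omega^{-1}(y)=\exp(y^{1/A})$ for $y\ge 0$ is the inverse of $\omega$ on $[1,\infty)$. The derivative $\omega'$ is strictly decreasing on $(e^{A-1},\infty)$ (the point $e^{A-1}$ is the inflection point of $\omega$), and $\tilde\omega:=(\omega')^{-1}$ denotes the inverse function of $\omega'$ restricted to $(e^{A-1},\infty)$. For real $k>0$ and integer $r\ge 1$ with $r/k\in\omega'((e^{A-1},\infty))$, put $x_{k,r}:=\tilde\omega(r/k)$ (the stationary point of $x\mapsto k\omega(x)-rx$ in $(e^{A-1},\infty)$) and $\phi(k,r):=k\,\omega(x_{k,r})-r\,x_{k,r}$. *)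

(* Defs.v *)
From HB Require Import structures.
From mathcomp Require Import all_boot all_order all_algebra.
From mathcomp Require Import all_classical all_reals all_analysis.

Set Implicit Arguments.
Unset Strict Implicit.
Unset Printing Implicit Defensive.

Import Order.TTheory GRing.Theory Num.Theory.
Import numFieldNormedType.Exports.

Local Open Scope ring_scope.
Local Open Scope classical_set_scope.

Section Definitions.
Context {R : realType}.
Implicit Types (A k x y s mu : R) (r h : int).

(* Only the values at x >= 1 are meaningful; there [ln x >= 0], and
   [omega A 1 = 0] because [0 `^ A = 0] for [A != 0]. *)
Definition omega A x : R := ln x `^ A.

Definition omega_inv A y : R := expR (y `^ A^-1).

Definition concave_range A : set R := [set x | expR (A - 1) < x].

(* Outside [(omega A)^`() @` concave_range A] the value is arbitrary. *)
Definition omega_tilde A : R -> R := pinv (concave_range A) (omega A)^`().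

Definition phi_dom A r : set R :=
  [set k | 0 < k /\ ((omega A)^`() @` concave_range A) (r%:~R / k)].

Definition stat_x A k r : R := omega_tilde A (r%:~R / k).

Definition phi A k r : R := k * omega A (stat_x A k r) - r%:~R * stat_x A k r.

(* mu is a stationary point of k |-> phi(k, r) - (h - s) k.  [phi_dom A r] is an
   open set, so the derivative at mu only involves values of [phi A ^~ r] on its
   domain. *)
Definition stationary A h r s mu : Prop :=
  [/\ phi_dom A r mu,
      derivable (phi A ^~ r) mu 1 &
      (phi A ^~ r)^`() mu = h%:~R - s].

(* Default value 0 if there is no stationary point. *)
Definition mu_ A h r s : R := xget 0 [set mu | stationary A h r s mu].

Definition Phi A h r s : R :=
  phi A (mu_ A h r s) r - (h%:~R - s) * mu_ A h r s.

Lemma omegaK A : 0 < A -> {in [pred x | 1 <= x], cancel (omega A) (omega_inv A)}.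
Proof.
move=> A0 x; rewrite inE => x1.
rewrite /omega_inv /omega -powRrM mulfV ?gt_eqF// powRr1 ?ln_ge0// lnK//.
by rewrite posrE (lt_le_trans ltr01).
Qed.

Lemma omega_invK A : 0 < A -> {in [pred y | 0 <= y], cancel (omega_inv A) (omega A)}.
Proof.
move=> A0 y; rewrite inE => y0.
by rewrite /omega_inv /omega expRK -powRrM mulVf ?gt_eqF// powRr1.
Qed.

End Definitions.

(* Main.v *)
Require Import Defs.
From HB Require Import structures.
From mathcomp Require Import all_boot all_order all_algebra.
From mathcomp Require Import all_classical all_reals all_analysis.
From mathcomp Require Import ring.
Import Order.TTheory GRing.Theory Num.Theory.
Import numFieldNormedType.Exports.
Local Open Scope ring_scope.
Local Open Scope classical_set_scope.

(** Since [omega'' < 0] on the concave range, [omega_tilde] is differentiable on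
    the open image of [omega'], and the envelope identity kills the contribution
    of the moving stationary point: [phi(., r)' (k) = omega (x_{k,r})].
    Stationarity of [k |-> phi (k, r) - (h - s) k] thus says
    [x_{k,r} = omega_inv (h - s)], which determines [k] through
    [omega' (x_{k,r}) = r / k]; differentiating [omega (x_{k,r})] once more gives
    the second derivative. *)

Lemma is_derive1_comp {R : realType} (f g : R -> R) (x df dg : R) :
  is_derive x 1 g dg -> is_derive (g x) 1 f df ->
  is_derive x 1 (f \o g) (df * dg).
Proof.
move=> [dgx <-] [dfx <-]; split.
  apply/derivable1_diffP/differentiable_comp; exact/derivable1_diffP.
by rewrite -derive1E derive1_comp// !derive1E.
Qed.

Lemma is_derive_continuous {R : realType} (f : R -> R) (x df : R) :
  is_derive x 1 f df -> {for x, continuous f}.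
Proof. by move=> [/derivable1_diffP/differentiable_continuous]. Qed.

Lemma is_derive1E {R : realType} (f : R -> R) (x df : R) :
  is_derive x 1 f df -> f^`() x = df.
Proof. by move=> [_ <-]; rewrite derive1E. Qed.

(** * First and second derivatives of [omega] *)

Lemma is_derive_omega {R : realType} (A x : R) : 1 < x ->
  is_derive x 1 (omega A) (A * ln x `^ (A - 1) / x).
Proof.
move=> x1; have x0 : 0 < x by exact: lt_trans x1.
have lx0 : 0 < ln x by rewrite ln_gt0.
exact: (is_derive1_comp (fun y => y `^ A) _ _ _ _ (is_derive1_ln x0)
  (is_derive1_powR A lx0)).
Qed.

Lemma derive1_omega {R : realType} (A x : R) : 1 < x ->
  derive1 (omega A) x = A * ln x `^ (A - 1) / x.
Proof. by move=> x1; apply: is_derive1E; exact: is_derive_omega. Qed.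

Lemma is_derive_derive1_omega {R : realType} (A x : R) : 1 < x ->
  is_derive x 1 (derive1 (omega A))
    (A * ln x `^ (A - 1 - 1) * (A - 1 - ln x) / x ^+ 2).
Proof.
move=> x1; have x0 : 0 < x by exact: lt_trans x1.
have lx0 : 0 < ln x by rewrite ln_gt0.
(* The closed form of the first derivative holds only beyond 1, hence near [x]; writing its
   logarithmic factor as [omega (A - 1)] lets [is_derive_omega] be reused. *)
apply: (@near_eq_is_derive _ _ _ (fun y => A * (omega (A - 1) y * y^-1))).
  near=> y; rewrite derive1_omega ?mulrA//.
  by near: y; exact: lt_nbhsr.
have xn0 : x != 0 by rewrite gt_eqF.
have := is_derive_omega (A - 1) x x1 => d1.
have d2 : is_derive x 1 (fun y : R => y^-1) (- x ^- 2 *: 1).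
  by apply: is_deriveV.
apply: is_derive_eq.
rewrite /omega /GRing.scale/=.
have -> : ln x `^ (A - 1) = ln x `^ (A - 1 - 1) * ln x.
  have lxn0 : ln x != 0 by rewrite gt_eqF.
  by rewrite [in RHS]powRB ?lxn0 ?implybT// powRr1 ?divfK// ltW.
by field.
Unshelve. all: by end_near. Qed.

(** * Strict concavity of [omega] beyond its inflection point *)

Lemma concave_range_gt1 {R : realType} (A x : R) : 1 < A ->
  concave_range A x -> 1 < x.
Proof. by move=> A1; apply: lt_trans; rewrite expR_gt1 subr_gt0. Qed.

Lemma near_concave_range {R : realType} (A x : R) :
  concave_range A x -> \forall y \near x, concave_range A y.
Proof. exact: lt_nbhsr. Qed.

Lemma derive1n2_omega_lt0 {R : realType} (A x : R) : 1 < A ->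
  concave_range A x -> derive1n 2 (omega A) x < 0.
Proof.
move=> A1 Ix; have x1 := concave_range_gt1 A x A1 Ix.
have x0 : 0 < x by exact: lt_trans x1.
rewrite [_ x](is_derive1E _ _ _ (is_derive_derive1_omega A x x1)).
rewrite pmulr_llt0 ?invr_gt0 ?exprn_gt0// pmulr_rlt0; last first.
  by rewrite mulr_gt0 ?powR_gt0 ?ln_gt0// (lt_trans ltr01).
(* The sign is that of [A - 1 - ln x], negative exactly beyond the inflection point. *)
by rewrite subr_lt0 -ltr_expR lnK.
Qed.

(** The range is a ray, so it contains the segment between any two of its points; there the negative
    second derivative makes the first one strictly decreasing. *)
Lemma derive1_omega_inj {R : realType} (A : R) : 1 < A ->
  {in concave_range A &, injective (derive1 (omega A))}.
Proof.
move=> A1.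
have lt x y : concave_range A x -> x < y ->
    derive1 (omega A) y < derive1 (omega A) x.
  move=> Ix xy.
  have I z : z \in `[x, y]%R -> concave_range A z.
    by rewrite in_itv/= => /andP[xz _]; exact: lt_le_trans Ix xz.
  have d z : z \in `[x, y]%R -> derivable (derive1 (omega A)) z 1.
    move=> /I /(concave_range_gt1 _ _ A1) z1.
    by have [] := is_derive_derive1_omega A z z1.
  apply: (@ltr0_derive1_lt_cc _ _ x y) => //.
  - by move=> z /subset_itv_oo_cc; exact: d.
  - move=> z /subset_itv_oo_cc /I; exact: derive1n2_omega_lt0.
  - exact: derivable_within_continuous.
  - by rewrite in_itv/= lexx ltW.
  - by rewrite in_itv/= lexx ltW.
move=> x y; rewrite !inE => Ix Iy exy; apply/eqP; rewrite eq_le !leNgt.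
by apply/andP; split; apply/negP; [move=> /(lt _ _ Iy)|move=> /(lt _ _ Ix)];
  rewrite exy ltxx.
Qed.

(** * The inverse of the first derivative *)

Lemma omega_tildeK {R : realType} (A x : R) : 1 < A -> concave_range A x ->
  omega_tilde A (derive1 (omega A) x) = x.
Proof.
by move=> A1 Ix; rewrite /omega_tilde pinvKV ?inE//; exact: derive1_omega_inj.
Qed.

Lemma near_omega_tildeK {R : realType} (A x : R) : 1 < A ->
  concave_range A x ->
  {near x, cancel (derive1 (omega A)) (omega_tilde A)} /\
  {near x, continuous (derive1 (omega A))}.
Proof.
move=> A1 Ix; split; near=> z.
  by apply: omega_tildeK => //; near: z; exact: near_concave_range.
apply: is_derive_continuous; apply: is_derive_derive1_omega.
by apply: (concave_range_gt1 A) => //; near: z; exact: near_concave_range.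
Unshelve. all: by end_near. Qed.

(** This gives openness of the image. The local inverse is continuous, so [omega_tilde A y] stays in
    the open ray for [y] close to the base value and serves as a preimage of [y]. *)
Lemma near_image_derive1_omega {R : realType} (A x : R) : 1 < A ->
  concave_range A x ->
  \forall y \near derive1 (omega A) x, (derive1 (omega A) @` concave_range A) y.
Proof.
move=> A1 Ix; have [fK fC] := near_omega_tildeK A x A1 Ix.
have [gC gK] := near_can_continuousAcan_sym fK fC.
have gx : {for derive1 (omega A) x, continuous (omega_tilde A)}.
  by move: gC => /nbhs_singleton.
near=> y; exists (omega_tilde A y); last by near: y.
near: y; apply: gx; rewrite omega_tildeK//; exact: near_concave_range.
Unshelve. all: by end_near. Qed.

Lemma is_derive_omega_tilde {R : realType} (A x : R) : 1 < A ->
  concave_range A x ->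
  is_derive (derive1 (omega A) x) 1 (omega_tilde A) (derive1n 2 (omega A) x)^-1.
Proof.
move=> A1 Ix; have [fK fC] := near_omega_tildeK A x A1 Ix.
have d := is_derive_derive1_omega A x (concave_range_gt1 A x A1 Ix).
have w0 := derive1n2_omega_lt0 A x A1 Ix.
apply: (is_derive_inverse fK fC); last by rewrite lt_eqF.
by rewrite derive1nS derive1n1 (is_derive1E _ _ _ d).
Qed.

(** * Differentiation of the stationary point and of [phi] *)

Lemma stat_xP {R : realType} (A k : R) (r : int) : 1 < A -> phi_dom A r k ->
  concave_range A (stat_x A k r) /\ derive1 (omega A) (stat_x A k r) = r%:~R / k.
Proof. by move=> A1 [_ [x Ix xk]]; rewrite /stat_x -xk omega_tildeK. Qed.

Lemma is_derive_divl {R : realType} (a k : R) : k != 0 ->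
  is_derive k 1 (fun t => a / t) (- (a / k ^+ 2)).
Proof.
move=> k0.
have d2 : is_derive k 1 (fun y : R => y^-1) (- k ^- 2 *: 1).
  by apply: is_deriveV.
apply: is_derive_eq.
rewrite /GRing.scale/=.
by field.
Qed.

(** The formula for the derivative of [phi] is available only on [phi_dom]; openness makes it hold
    on a neighbourhood, so that it can be differentiated again. *)
Lemma near_phi_dom {R : realType} (A k : R) (r : int) : 1 < A ->
  phi_dom A r k -> \forall t \near k, phi_dom A r t.
Proof.
move=> A1 dk; have [k0 _] := dk; have [Ix xk] := stat_xP A k r A1 dk.
have kn0 : k != 0 by rewrite gt_eqF.
have c := is_derive_continuous _ _ _ (is_derive_divl r%:~R k kn0).
near=> t; split; first by near: t; exact: lt_nbhsr.
near: t; apply: c; rewrite -xk; exact: near_image_derive1_omega.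
Unshelve. all: by end_near. Qed.

Lemma is_derive_stat_x {R : realType} (A k : R) (r : int) : 1 < A ->
  phi_dom A r k ->
  is_derive k 1 (stat_x A ^~ r)
    ((derive1n 2 (omega A) (stat_x A k r))^-1 * - (r%:~R / k ^+ 2)).
Proof.
move=> A1 dk; have [k0 _] := dk; have [Ix xk] := stat_xP A k r A1 dk.
apply: (@is_derive1_comp _ (omega_tilde A) (fun t => r%:~R / t)).
  by apply: is_derive_divl; rewrite gt_eqF.
by rewrite -xk; exact: is_derive_omega_tilde.
Qed.

Lemma is_derive_omega_stat_x {R : realType} (A k : R) (r : int) : 1 < A ->
  phi_dom A r k ->
  is_derive k 1 (omega A \o stat_x A ^~ r)
    (r%:~R / k * ((derive1n 2 (omega A) (stat_x A k r))^-1 *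
                  - (r%:~R / k ^+ 2))).
Proof.
move=> A1 dk; have [Ix <-] := stat_xP A k r A1 dk.
apply: is_derive1_comp; first exact: is_derive_stat_x.
have x1 := concave_range_gt1 A _ A1 Ix.
by rewrite derive1_omega//; exact: is_derive_omega.
Qed.

Lemma is_derive_phi {R : realType} (A k : R) (r : int) : 1 < A ->
  phi_dom A r k -> is_derive k 1 (phi A ^~ r) (omega A (stat_x A k r)).
Proof.
move=> A1 dk; have [k0 _] := dk.
have [Ix _] := stat_xP A k r A1 dk.
have w0 := derive1n2_omega_lt0 A _ A1 Ix.
have dx := is_derive_stat_x A k r A1 dk.
have dox := is_derive_omega_stat_x A k r A1 dk.
have -> : phi A ^~ r =
    (fun t => t * (omega A \o stat_x A ^~ r) t - r%:~R * stat_x A t r) by [].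
apply: is_derive_eq.
rewrite /GRing.scale/=; rewrite /= in w0.
(* Envelope cancellation: [k] times the derivative [r / k] of [omega] at the stationary point is
   [r], so both terms carrying the derivative of [stat_x] cancel. *)
by field; rewrite ?(lt_eqF w0) ?(gt_eqF k0).
Qed.

Lemma is_derive_derive1_phi {R : realType} (A k : R) (r : int) : 1 < A ->
  phi_dom A r k ->
  is_derive k 1 (derive1 (phi A ^~ r))
    (r%:~R / k * ((derive1n 2 (omega A) (stat_x A k r))^-1 *
                  - (r%:~R / k ^+ 2))).
Proof.
move=> A1 dk; apply: near_eq_is_derive (is_derive_omega_stat_x A k r A1 dk).
near=> t; apply/esym/is_derive1E/is_derive_phi => //.
by near: t; exact: near_phi_dom.
Unshelve. all: by end_near. Qed.

Lemma omega_inv_concave_range {R : realType} (A y : R) : 1 < A ->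
  (A - 1) `^ A < y -> concave_range A (omega_inv A y).
Proof.
move=> A1 hy; have A0 : 0 < A by exact: lt_trans A1.
have B0 : 0 <= A - 1 by rewrite subr_ge0 ltW.
rewrite /concave_range /omega_inv /= ltr_expR.
have -> : A - 1 = ((A - 1) `^ A) `^ A^-1.
  by rewrite -powRrM mulfV ?gt_eqF// powRr1.
apply: gt0_ltr_powR => //; rewrite ?invr_gt0 ?nnegrE ?powR_ge0//.
by rewrite ltW// (le_lt_trans _ hy)// powR_ge0.
Qed.

(** An equivalence yields existence and uniqueness together. Forwards, inverting [omega] identifies
    [stat_x], and its defining equation is solved for [mu]; backwards, [mu] is chosen so that
    [r / mu] is the slope at [x]. *)
Lemma stationaryP {R : realType} (A mu s : R) (h r : int) : 1 < A -> 1 <= r ->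
  (A - 1) `^ A < h%:~R - s ->
  stationary A h r s mu <->
  mu = r%:~R / derive1 (omega A) (omega_inv A (h%:~R - s)).
Proof.
move=> A1 r1 hhs; set y := h%:~R - s; set x := omega_inv A y.
have A0 : 0 < A by exact: lt_trans A1.
have r0 : 0 < r%:~R :> R by rewrite ltr0z (lt_le_trans ltr01).
have Ix : concave_range A x by exact: omega_inv_concave_range.
have x1 := concave_range_gt1 A x A1 Ix.
have w0 : 0 < derive1 (omega A) x.
  by rewrite derive1_omega// divr_gt0 ?mulr_gt0 ?powR_gt0 ?ln_gt0// (lt_trans _ x1).
have y0 : 0 <= y by rewrite ltW// (le_lt_trans _ hhs)// powR_ge0.
split=> [[dmu _ ]|mux].
  have [k0 _] := dmu; have [Imu xmu] := stat_xP A mu r A1 dmu.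
  have xK : omega_inv A (omega A (stat_x A mu r)) = stat_x A mu r.
    by apply: omegaK => //; rewrite inE ltW// (concave_range_gt1 A).
  rewrite (is_derive1E _ _ _ (is_derive_phi A mu r A1 dmu)) -/y => oy.
  rewrite oy -/x in xK; rewrite xK.
  by rewrite xmu invf_div mulrCA mulfV ?mulr1// gt_eqF.
have rmu : r%:~R / mu = derive1 (omega A) x.
  by rewrite mux invf_div mulrCA mulfV ?mulr1// gt_eqF.
have mu0 : 0 < mu by rewrite mux divr_gt0.
have dmu : phi_dom A r mu by split=> //; rewrite rmu; exists x.
have d := is_derive_phi A mu r A1 dmu; split => //.
by rewrite (is_derive1E _ _ _ d) /stat_x rmu omega_tildeK// omega_invK.
Qed.

Theorem lemma4p10 (R : realType) (A : R) (hA : 1 < A)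
    (r h : int) (hr : 1 <= r) (s : R) (hs : 0 <= s <= 1)
    (hhs : (A - 1) `^ A < h%:~R - s) :
  (exists! mu : R, stationary A h r s mu) /\
  (let mu := mu_ A h r s in
   [/\ mu = r%:~R / derive1 (omega A) (omega_inv A (h%:~R - s)),
       Phi A h r s = - r%:~R * omega_inv A (h%:~R - s),
       derivable (derive1 (phi A ^~ r)) mu 1 &
       mu * derive1n 2 (omega A) (stat_x A mu r) * derive1n 2 (phi A ^~ r) mu
         = - (r%:~R ^+ 2 / mu ^+ 2)]).
Proof.
have A0 : 0 < A by exact: lt_trans hA.
have statP mu := @stationaryP R A mu s h r hA hr hhs.
set m := _ / _ in statP.
split; first by exists m; split=> [|mu /statP->//]; apply/statP.
rewrite /Phi; move E : (mu_ A h r s) => mu /=.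
have smu : stationary A h r s mu.
  (* The witness [m] rules out the default value of [xget]. *)
  by rewrite -E; apply: (@xgetPex _ 0 (stationary A h r s)); exists m; apply/statP.
have /statP mum := smu; have [dmu _] := smu.
rewrite (is_derive1E _ _ _ (is_derive_phi A mu r hA dmu)) => oy.
have [mu0 _] := dmu; have [Ix xmu] := stat_xP A mu r hA dmu.
have d2 := is_derive_derive1_phi A mu r hA dmu.
have w0 := derive1n2_omega_lt0 A _ hA Ix.
split => //.
- have xK : omega_inv A (omega A (stat_x A mu r)) = stat_x A mu r.
    by apply: omegaK => //; rewrite inE ltW// (concave_range_gt1 A).
  (* As [h - s] equals [omega] at the stationary point, the terms with factor [mu] cancel and only
     [- r * stat_x] remains. *)
  by rewrite /phi -oy xK; ring.
- rewrite (is_derive1E _ _ _ d2) /=; rewrite /= in w0.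
  (* The second derivative of [omega] cancels against its inverse, which comes from the derivative
     of [omega_tilde]. *)
  by field; rewrite ?(lt_eqF w0) ?(gt_eqF mu0).
Qed.
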